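(* Let $k$ be a field of characteristic not two with algebraic closure $\overline{k}$, let $m \geq 2$ be an integer, and let $\lambda_1, \lambda_2 \in \overline{k}$. Then $\lambda_1$ and $\lambda_2$ are an $m$-valid eigenpair if and only if one of the following holds: (a) $\lambda_1$ is a primitive $2m$-th root of unity and $\lambda_2 = \lambda_1^{2m-1}$; or (b) $m$ is odd, $\lambda_1$ is a primitive $m$-th root of unity and $\lambda_2 = \lambda_1^{m-1}$.
   Context: For $A \in \mathrm{GL}(2,\overline{k})$, $\operatorname{Inn}_A$ denotes the map $X \mapsto A^{-1}XA$. A pair $\lambda_1,\lambda_2 \in \overline{k}$ is called an $m$-valid eigenpair if $A = \begin{pmatrix}\lambda_1 & 0\\ 0 & \lambda_2\end{pmatrix}$ lies in $\mathrm{SL}(2,\overline{k})$ and $\operatorname{Inn}_A$ is an automorphism of $\mathrm{SL}(2,\overline{k})$ of order (exactly) $m$. *)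

(* Defs.v *)
From HB Require Import structures.
From mathcomp Require Import all_boot all_order all_fingroup all_algebra.

Set Implicit Arguments.
Unset Strict Implicit.
Unset Printing Implicit Defensive.

Import GRing.Theory.
Local Open Scope ring_scope.

(* [K] is closed by its type, so algebraicity over the image of [k] is what
   remains to be required of an algebraic closure. *)
Definition is_algebraic_closure (k : fieldType) (K : closedFieldType)
    (iota : {rmorphism k -> K}) : Prop :=
  forall x : K, algebraicOver iota x.

Section SpecialLinear.
Variables (n : nat) (R : comUnitRingType).

Record SL : predArgType := MkSL { SLval : 'M[R]_n; _ : \det SLval == 1 }.

HB.instance Definition _ := [isSub for SLval].
HB.instance Definition _ := [Choice of SL by <:].

Implicit Types X Y Z : SL.

Lemma det_SL X : \det (val X) = 1.
Proof. exact/eqP/(valP X). Qed.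

Lemma SL_unitmx X : val X \in unitmx.
Proof. by rewrite unitmxE det_SL unitr1. Qed.

Fact SL_one_subproof : \det (1%:M : 'M[R]_n) == 1.
Proof. by rewrite det1. Qed.
Definition SL_one : SL := MkSL SL_one_subproof.

Fact SL_mul_subproof X Y : \det (val X *m val Y) == 1.
Proof. by rewrite det_mulmx !det_SL mulr1. Qed.
Definition SL_mul X Y : SL := MkSL (SL_mul_subproof X Y).

Fact SL_inv_subproof X : \det (invmx (val X)) == 1.
Proof. by rewrite det_inv det_SL invr1. Qed.
Definition SL_inv X : SL := MkSL (SL_inv_subproof X).

Fact SL_mulA : associative SL_mul.
Proof. by move=> X Y Z; apply/val_inj; rewrite /= mulmxA. Qed.

Fact SL_mul1 : left_id SL_one SL_mul.
Proof. by move=> X; apply/val_inj; rewrite /= mul1mx. Qed.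

Fact SL_mulr1 : right_id SL_one SL_mul.
Proof. by move=> X; apply/val_inj; rewrite /= mulmx1. Qed.

Fact SL_mulV : left_inverse SL_one SL_inv SL_mul.
Proof. by move=> X; apply/val_inj; rewrite /= mulVmx ?SL_unitmx. Qed.

Fact SL_mulrV : right_inverse SL_one SL_inv SL_mul.
Proof. by move=> X; apply/val_inj; rewrite /= mulmxV ?SL_unitmx. Qed.

HB.instance Definition _ := isGroup.Build SL
  SL_mulA SL_mul1 SL_mulr1 SL_mulV SL_mulrV.

End SpecialLinear.

Definition Inn (n : nat) (R : comUnitRingType) (A X : 'M[R]_n) : 'M[R]_n :=
  invmx A *m X *m A.

Definition has_order (T : Type) (f : T -> T) (m : nat) : Prop :=
  [/\ (0 < m)%N, iter m f =1 id &
      forall j : nat, (0 < j)%N -> iter j f =1 id -> (m <= j)%N].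

(* [phi] is the map that [Inn A] induces on SL(n, R); its existence says that
   [Inn A] preserves SL(n, R). *)
Definition Inn_is_aut_of_order (n : nat) (R : comUnitRingType)
    (A : 'M[R]_n) (m : nat) : Prop :=
  exists phi : {multiplicative SL n R -> SL n R},
    [/\ forall X : SL n R, val (phi X) = Inn A (val X),
        bijective phi & has_order phi m].

Definition diag2 (R : comUnitRingType) (a b : R) : 'M[R]_2 :=
  diag_mx (\row_(i < 2) (if i == 0 then a else b)).

Definition valid_eigenpair (K : closedFieldType) (m : nat) (l1 l2 : K) : Prop :=
  \det (diag2 l1 l2) = 1 /\ Inn_is_aut_of_order (diag2 l1 l2) m.

(* Main.v *)
Require Import Defs.
From HB Require Import structures.
From mathcomp Require Import all_boot all_order all_fingroup all_algebra.
Set Implicit Arguments.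
Unset Strict Implicit.
Unset Printing Implicit Defensive.

Import GRing.Theory.
Local Open Scope ring_scope.

(** Conjugation by [diag2 a a^-1] fixes the diagonal entries of a matrix and
    multiplies the other two by [a ^+ 2] and its inverse, so its order is the
    multiplicative order of [a ^+ 2].  If [a] has order [d], then [a ^+ 2] has
    order [d] or [d / 2] according to the parity of [d]. *)

(** Puts primitivity in the shape of [has_order], so that the two orders can be compared clause by
    clause. *)
Lemma prim_root_leP (R : nzRingType) (m : nat) (z : R) :
  m.-primitive_root z <->
  [/\ (0 < m)%N, z ^+ m = 1 &
      forall j : nat, (0 < j)%N -> z ^+ j = 1 -> (m <= j)%N].
Proof.
split=> [prim_z | [m_gt0 zm1 z_min]].
  split=> [||j j_gt0 zj1]; first exact: prim_order_gt0 prim_z.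
    exact: prim_expr_order.
  by apply: dvdn_leq; rewrite // (prim_order_dvd prim_z) zj1.
have [d prim_d d_m] := prim_order_exists m_gt0 zm1.
suff -> : m = d by [].
apply/eqP; rewrite eqn_leq (dvdn_leq _ d_m) // andbT.
by apply: z_min; [exact: prim_order_gt0 prim_d | exact: prim_expr_order].
Qed.

Lemma prim_root_order_uniq (R : nzRingType) (m n : nat) (z : R) :
  m.-primitive_root z -> n.-primitive_root z -> m = n.
Proof.
move=> prim_m prim_n; apply/eqP; rewrite eqn_dvd.
by rewrite (prim_order_dvd prim_m) (prim_order_dvd prim_n) !prim_expr_order ?eqxx.
Qed.

Lemma prim_root_sqr (R : nzRingType) (m : nat) (z : R) :
  m.-primitive_root (z ^+ 2) <->
  (2 * m).-primitive_root z \/ odd m /\ m.-primitive_root z.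
Proof.
split=> [prim_z2 | [prim_z | [odd_m prim_z]]]; last 2 first.
- by have := exp_prim_root prim_z 2; rewrite gcdnMr mulKn.
- have := exp_prim_root prim_z 2.
  by rewrite (eqP (_ : coprime 2 m)) ?divn1 ?coprime2n.
have m_gt0 := prim_order_gt0 prim_z2.
have z2m : z ^+ (2 * m) = 1 by rewrite exprM prim_expr_order.
(* For [d] the exact order of [z], the order of [z ^+ 2] is [d %/ gcdn 2 d]. Equating it with [m]
   gives [d = m] for odd [d] and [d = 2 * m] for even [d]. *)
have [|d prim_d _] := prim_order_exists _ z2m; first by rewrite muln_gt0.
have := prim_root_order_uniq (exp_prim_root prim_d 2) prim_z2.
have [odd_d | even_d] := boolP (odd d).
  rewrite (eqP (_ : coprime 2 d)) ?coprime2n // divn1 => <-.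
  by right.
have d2 : (2 %| d)%N by rewrite dvdn2.
rewrite (gcdn_idPl d2) => <-; left.
by rewrite mulnC divnK.
Qed.

(** Since [a ^+ n = 1], the power [a ^+ (n - 1)] is the inverse of [a]. This turns the determinant
    condition into the formulas for [l2]. *)
Lemma prim_root_mul_eq1 (F : fieldType) (n : nat) (a b : F) :
  n.-primitive_root a -> (a * b = 1 <-> b = a ^+ (n - 1)).
Proof.
move=> prim_a; have n_gt0 := prim_order_gt0 prim_a.
have a_neq0 : a != 0 by rewrite (prim_root_eq0 prim_a) -lt0n.
have aV : a * a ^+ (n - 1) = 1.
  by rewrite -exprS subn1 prednK // prim_expr_order.
split=> [ab1 | -> //].
by apply: (mulfI a_neq0); rewrite ab1 aV.
Qed.

Lemma det_diag2 (R : comUnitRingType) (a b : R) : \det (diag2 a b) = a * b.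
Proof. by rewrite det_diag big_ord_recl big_ord1 !mxE. Qed.

Lemma val_conj_SL (n : nat) (R : comUnitRingType) (X Y : SL n R) :
  val (conjg X Y) = Inn (val Y) (val X).
Proof. by rewrite /Inn -mulmxA. Qed.

(** Injectivity of [val] forces any witness [phi] to be conjugation by [A] in the group; conversely
    that conjugation is multiplicative, with inverse conjugation by [A^-1]. *)
Lemma Inn_is_aut_of_orderP (n : nat) (R : comUnitRingType) (A : SL n R)
    (m : nat) :
  Inn_is_aut_of_order (val A) m <-> has_order (fun X : SL n R => conjg X A) m.
Proof.
split=> [[phi [phiE _ [m_gt0 phi_m phi_min]]] | orderA].
  have eq_phi : phi =1 conjg^~ A.
    by move=> X; apply: val_inj; rewrite phiE val_conj_SL.
  split=> // [X | j j_gt0 jA].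
    by rewrite -(eq_iter eq_phi) phi_m.
  by apply: phi_min => // X; rewrite (eq_iter eq_phi) jA.
have phiM : {morph conjg^~ A : X Y / (X * Y)%g} by move=> X Y; exact: conjMg.
pose phi_mixin := isMultiplicative.Build (SL n R) (SL n R) (conjg^~ A) phiM.
pose phi : {multiplicative SL n R -> SL n R} :=
  HB.pack (fun X : SL n R => conjg X A) phi_mixin.
exists phi; split=> // [X | ]; first exact: val_conj_SL.
by exists (conjg^~ A^-1%g) => X; [exact: conjgK | exact: conjgKV].
Qed.

Lemma iter_conjg (G : groupType) (x y : G) (j : nat) :
  iter j (fun z => conjg z y) x = conjg x (y ^+ j)%g.
Proof.
elim: j => [|j IHj]; first by rewrite expg0 conjg1.
by rewrite iterS IHj -conjgM expgSr.
Qed.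

Lemma val_expg_SL (n : nat) (R : comUnitRingType) (X : SL n R) (s : 'rV[R]_n) :
  val X = diag_mx s ->
  forall j : nat, val (X ^+ j)%g = diag_mx (\row_i (s 0 i ^+ j)).
Proof.
move=> XE; elim=> [|j IHj].
  by apply/matrixP=> i i'; rewrite expg0 !mxE expr0.
(* Simplification exposes [SLval], which is folded back to [val] so that [IHj] and [XE] apply. *)
rewrite expgSr [LHS]/= -[SLval _]/(val (X ^+ j)%g) IHj -[SLval X]/(val X) XE.
rewrite mulmx_diag; congr diag_mx; apply/rowP=> i.
by rewrite !mxE exprSr.
Qed.

Lemma SL_conjg_fixE (n : nat) (R : comUnitRingType) (X Y : SL n R) :
  conjg X Y = X <-> val X *m val Y = val Y *m val X.
Proof.
split=> [XY | XY].
  by have := congr1 val (conjgC X Y); rewrite XY.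
by apply: (mulgI Y); rewrite -conjgC; apply: val_inj.
Qed.

(* The unitriangular matrix [1 0; 1 1] detects whether conjugation by a
   diagonal matrix is trivial. *)
Lemma conjg_diag2_id (F : fieldType) (A : SL 2 F) (a b : F) :
  val A = diag2 a b ->
  (conjg^~ A =1 id) <-> a = b.
Proof.
move=> AE; split=> [Aid | ab X]; last first.
  apply/SL_conjg_fixE; rewrite AE ab; suff -> : diag2 b b = b%:M.
    by rewrite scalar_mxC.
  by apply/matrixP=> i j; rewrite !mxE if_same.
pose u : 'M[F]_2 := \matrix_(i, j) (j <= i)%:R.
have u_trig : is_trig_mx u.
  by apply/is_trig_mxP=> i j lt_ij; rewrite mxE leqNgt lt_ij.
have det_u : \det u == 1.
  by rewrite det_trig // big1 // => i _; rewrite mxE leqnn.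
(* The lower left entry is [a] in the product of [u] by [A] and [b] in the product of [A] by [u]. *)
have /SL_conjg_fixE/matrixP/(_ 1 0) := Aid (MkSL det_u).
by rewrite /= AE mul_diag_mx mul_mx_diag !mxE /= mul1r mulr1.
Qed.

Theorem theorem5p4 (k : fieldType) (kbar : closedFieldType)
    (iota : {rmorphism k -> kbar}) (kbar_closure : is_algebraic_closure iota)
    (char_k : 2%N \notin [pchar k]) (m : nat) (m_ge2 : (2 <= m)%N)
    (l1 l2 : kbar) :
  valid_eigenpair m l1 l2 <->
    ((2 * m).-primitive_root l1 /\ l2 = l1 ^+ (2 * m - 1)) \/
    [/\ odd m, m.-primitive_root l1 & l2 = l1 ^+ (m - 1)].
Proof.
have valid_sqr : valid_eigenpair m l1 l2 <->
    l1 * l2 = 1 /\ m.-primitive_root (l1 ^+ 2).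
  rewrite /valid_eigenpair det_diag2.
  suff orderE : l1 * l2 = 1 ->
      Inn_is_aut_of_order (diag2 l1 l2) m <-> m.-primitive_root (l1 ^+ 2).
    by split=> -[l12 /(orderE l12)].
  move=> l12.
  have detA : \det (diag2 l1 l2) == 1 by rewrite det_diag2 l12.
  (* The iterate is conjugation by the [j]-th power of the matrix, hence trivial exactly when
     [l1 ^+ j = l2 ^+ j]. *)
  have iter_id j : iter j (conjg^~ (MkSL detA)) =1 id <-> (l1 ^+ 2) ^+ j = 1.
    have AjE : val (MkSL detA ^+ j)%g = diag2 (l1 ^+ j) (l2 ^+ j).
      rewrite (@val_expg_SL _ _ (MkSL detA) _ (erefl (diag2 l1 l2))); congr diag_mx; apply/rowP=> i.
      by rewrite !mxE; case: (i == 0).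
    have l1j : l1 ^+ j * l2 ^+ j = 1 by rewrite -exprMn l12 expr1n.
    have l1j_neq0 : l1 ^+ j != 0.
      by apply/eqP=> l1j0; move/eqP: l1j; rewrite l1j0 mul0r eq_sym oner_eq0.
    (* Writing 1 as [l1 ^+ j * l2 ^+ j] leaves a common factor [l1 ^+ j] to cancel. *)
    rewrite exprAC expr2 -l1j; split.
      move=> Aj; congr (_ * _); apply/(conjg_diag2_id AjE) => X.
      by rewrite -iter_conjg Aj.
    move=> /(mulfI l1j_neq0)/(conjg_diag2_id AjE) Aj X.
    by rewrite iter_conjg Aj.
  split=> [/(Inn_is_aut_of_orderP (MkSL detA)) | /prim_root_leP].
    move=> [m_gt0 /iter_id l1m l1_min]; apply/prim_root_leP; split=> // j j_gt0.
    by move/iter_id; exact: l1_min.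
  move=> [m_gt0 /iter_id l1m l1_min]; apply/(Inn_is_aut_of_orderP (MkSL detA)).
  by split=> // j j_gt0 /iter_id; exact: l1_min.
(* The two cases for the order of [l1] are (a) and (b); in each, [l1 * l2 = 1] determines [l2]. *)
split=> [/valid_sqr[l12 /prim_root_sqr[prim | [odd_m prim]]] | ].
- by left; split=> //; apply/(prim_root_mul_eq1 _ prim).
- by right; split=> //; apply/(prim_root_mul_eq1 _ prim).
move=> l12_prim; apply/valid_sqr.
case: l12_prim => [[prim l2E] | [odd_m prim l2E]]; split.
- exact/(prim_root_mul_eq1 _ prim).
- by apply/prim_root_sqr; left.
- exact/(prim_root_mul_eq1 _ prim).
- by apply/prim_root_sqr; right.
Qed.
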